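(* Let $0<p\le2$, let $S$ be a non-degenerate symmetric $p$-stable real random variable, and let $c=\{c_k:k\ge1\}$ with $c_k\in(0,\infty)$. Let $X$ be a random vector with values in a real separable F-space $B$, with law $\mu$, and let $t_k:B\to\mathbb{R}$, $k\ge1$, be Borel measurable functionals such that $\{t_k(X):k\ge1\}$ are independent with $\mathcal{L}(t_k(X))=\mathcal{L}(c_kS)$ for each $k$. Let $\mathcal{T}$ denote all finite linear combinations of $\{t_k:k\ge1\}$, and for $a\in B$ let $\tau(a)=\{t_k(a):k\ge1\}$. Then for every $a\in B$, $$HD_{\mathcal{T}}(a,\mu)=1-P(S\le\|\tau(a)/c\|_q),$$ where $q=\infty$ for $0<p\le1$ and $\frac1p+\frac1q=1$ for $1<p\le2$.
   Context: A real separable F-space is a real topological vector space whose topology is induced by a complete, separable, translation invariant metric; it carries its Borel sigma-field. $X$ is defined on a probability space $(\Omega,\mathcal{F},P)$, is Borel measurable, and $\mu=\mathcal{L}(X)$. The half space depth is $HD_{\mathcal{T}}(a,\mu)=\inf_{t\in\mathcal{T}}P(t(X)\ge t(a))$. A non-degenerate symmetric $p$-stable random variable has characteristic function $u\mapsto\exp(-\gamma|u|^p)$ for some $\gamma>0$ (for $p=2$ this is a centered Gaussian). $\tau(a)/c$ denotes the sequence $\{t_k(a)/c_k:k\ge1\}$. For a real sequence $y$, $\|y\|_q=(\sum_{j\ge1}|y_j|^q)^{1/q}$ for $q<\infty$ and $\|y\|_\infty=\sup_{j}|y_j|$, both possibly equal to $+\infty$; if $\|\tau(a)/c\|_q=\infty$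 the formula is interpreted as $HD_{\mathcal{T}}(a,\mu)=0$. *)

(* Defs.v *)
From HB Require Import structures.
From mathcomp Require Import all_boot all_order all_algebra finmap.
From mathcomp Require Import all_classical all_reals all_analysis.
From mathcomp.real_closed Require Import complex.

Set Implicit Arguments.
Unset Strict Implicit.
Unset Printing Implicit Defensive.

Import Order.TTheory GRing.Theory Num.Theory.
Import numFieldNormedType.Exports.

Local Open Scope classical_set_scope.
Local Open Scope ring_scope.

Record complete_invariant_metric {R : realType} (B : topologicalLmodType R)
    (rho : B -> B -> R) : Prop := CompleteInvariantMetric {
  metric_ge0 : forall x y, 0 <= rho x y ;
  metric_eq0 : forall x y, rho x y = 0 <-> x = y ;
  metric_sym : forall x y, rho x y = rho y x ;
  metric_triangle : forall x y z, rho x z <= rho x y + rho y z ;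
  metric_translation : forall x y z, rho (x + z) (y + z) = rho x y ;
  metric_topology : forall x : B,
    nbhs x = nbhs_ball_ (fun y e => [set z | rho y z < e]) x ;
  metric_complete : forall u : nat -> B,
    (forall e, 0 < e ->
       exists N, forall m n, (N <= m)%N -> (N <= n)%N -> rho (u m) (u n) < e) ->
    exists l : B, u @ \oo --> l
}.

Definition separable_Fspace {R : realType} (B : topologicalLmodType R) : Prop :=
  (exists rho : B -> B -> R, complete_invariant_metric rho) /\
  (exists2 D : set B, countable D & dense D).

(* [g_sigma_algebraType] needs a pointed type, which a [topologicalLmodType]
   is not; hence this alias of [B], pointed at 0. *)
Definition borel {R : realType} (B : topologicalLmodType R) : Type := B.

Section borel_instances.
Context {R : realType} (B : topologicalLmodType R).

HB.instance Definition _ := Choice.on (borel B).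
HB.instance Definition _ := isPointed.Build (borel B) (0 : B).

Let borelC (A : set (borel B)) : <<s @open B >> A -> <<s @open B >> (~` A).
Proof. by move=> mA; rewrite -setTD; exact: sigma_algebraCD. Qed.

HB.instance Definition _ := @isMeasurable.Build (sigma_display (@open B))
  (borel B) <<s @open B >> (@sigma_algebra0 _ setT (@open B)) borelC
  (@sigma_algebra_bigcup _ setT (@open B)).

End borel_instances.

Section probability.
Context {R : realType} {d : measure_display} {Omega : measurableType d}.
Variable P : probability Omega R.

Definition mutually_independent {I : choiceType} (Z : I -> Omega -> R) :=
  forall (J : {fset I}) (A : I -> set R),
    (forall i, i \in J -> measurable (A i)) ->
    P (\bigcap_(i in [set` J]) Z i @^-1` A i) =
    (\prod_(i <- J) P (Z i @^-1` A i))%E.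

(* E exp(iuZ), written out as E cos(uZ) + i E sin(uZ). *)
Definition char_fun (Z : Omega -> R) (u : R) : R[i] :=
  (fine 'E_P[fun w => cos (u * Z w)] +i* fine 'E_P[fun w => sin (u * Z w)])%C.

Definition nondegenerate_symmetric_stable (p : R) (Z : Omega -> R) :=
  exists2 gamma : R, 0 < gamma &
    forall u, char_fun Z u = (expR (- (gamma * `|u| `^ p)))%:C%C.

End probability.

(* Measures are total functions on sets, so their values off the measurable sets
   must be left out of the comparison. *)
Definition same_law {R : realType} {d d' : measure_display}
    {Omega : measurableType d} {Omega' : measurableType d'}
    (P : probability Omega R) (Y : Omega -> R)
    (Q : probability Omega' R) (Z : Omega' -> R) :=
  forall A : set R, measurable A -> pushforward P Y A = pushforward Q Z A.

Definition finite_linear_combinations {R : realType} {B : Type}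
    (t : nat -> B -> R) : set (B -> R) :=
  [set f | exists (n : nat) (lambda : nat -> R),
     f = (fun x => \sum_(k < n) lambda k * t k x)].

Definition half_space_depth {R : realType} {d : measure_display}
    {B : measurableType d} (T : set (B -> R)) (a : B)
    (mu : probability B R) : \bar R :=
  ereal_inf [set mu [set x | t a <= t x] | t in T].

(* The value +oo is allowed: the event [S <= +oo] then has probability 1, so the
   formula gives depth 0.  The case [q = -oo] is a dummy value. *)
Definition seq_norm {R : realType} (q : \bar R) (y : nat -> R) : \bar R :=
  match q with
  | r%:E => ((\sum_(0 <= j <oo) (`|y j| `^ r)%:E) `^ r^-1)%E
  | +oo%E => ereal_sup [set `|y j|%:E | j in [set: nat]]
  | -oo%E => 0%E
  end.

Definition depth_exponent {R : realType} (p : R) : \bar R :=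
  if p <= 1 then +oo%E else hoelder_conjugate p%:E.

(* Main.v *)
(** For finitely supported coefficients [l], the sum of the [l k * t k (X)] is
    distributed as [(\sum |l k * c k|^p)^(1/p) * S], so its tail at the value of
    the same combination at [a] is [P (S >= <b, y> / |b|_p)] with
    [b k = l k * c k] and [y k = t k a / c k].  By duality the supremum of these
    thresholds is [|y|_q] (for [p <= 1] the single coordinates already realise
    the sup norm), and the infimum of the tails is [P (S > |y|_q)] since [S] has
    no atoms.

    The identification of the law rests on the Cauchy kernel
    [k_e(y) = e / (e^2 + y^2)]: integrating [exp (- e u) (1 + cos (u y))] over
    [u >= 0] shows that [E k_e(X - x)] depends only on the characteristic
    function of [X]; integrating over [x >= a] and letting [e] tend to 0
    recovers [P (X >= a)].  The same formula bounds [P (X = x)], which is at most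
    [e E k_e(X - x)], and gives the absence of atoms. *)

Require Import Defs.
From HB Require Import structures.
From mathcomp Require Import all_boot all_order all_algebra finmap.
From mathcomp Require Import all_classical all_reals all_analysis.
From mathcomp Require Import measurable_realfun.
From mathcomp Require Import ring lra.

Set Implicit Arguments.
Unset Strict Implicit.
Unset Printing Implicit Defensive.

Import Order.TTheory GRing.Theory Num.Theory.
Import numFieldNormedType.Exports.

Local Open Scope classical_set_scope.
Local Open Scope ring_scope.

(** * The Cauchy kernel and its elementary integrals *)

Section cauchy_kernel.
Context {R : realType}.
Implicit Types e u x y z : R.
Local Notation lebesgue := (@lebesgue_measure R).

(** The Poisson kernel of the half-plane without its factor [1 / pi]: the total mass is [pi], which
    accounts for the factors [pi] below. *)
Definition cauchy_kernel e y : R := e / (e ^+ 2 + y ^+ 2).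

Lemma cauchy_denom_gt0 e y : 0 < e -> 0 < e ^+ 2 + y ^+ 2.
Proof. by move=> e0; rewrite ltr_wpDr ?sqr_ge0// exprn_gt0. Qed.

Lemma cauchy_kernel_ge0 e y : 0 < e -> 0 <= cauchy_kernel e y.
Proof. by move=> e0; rewrite divr_ge0 ?ltW// cauchy_denom_gt0. Qed.

Lemma cvg_expRN e : 0 < e -> expR (- (e * u)) @[u --> +oo] --> (0 : R).
Proof.
move=> e0.
apply: (@cvg_comp _ _ _ (fun u => e * u) (fun v => expR (- v))); last exact: cvgr_expR.
exact: gt0_cvgMry.
Qed.

(* The summand 1 makes the integrand nonnegative, so that Tonelli applies. *)
Lemma integral_exp_cos e y : 0 < e ->
  (\int[lebesgue]_(u in `[0%R, +oo[) (expR (- (e * u)) * (1 + cos (u * y)))%R%:E =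
  (e^-1 + cauchy_kernel e y)%:E)%E.
Proof.
move=> e0; pose f u := expR (- (e * u)) * (1 + cos (u * y)).
(* The antiderivative of [exp (- e u) cos (u y)] is the real part of
   [exp ((- e + i y) u) / (- e + i y)]. *)
pose F u := expR (- (e * u)) *
  (- e^-1 + (y * sin (u * y) - e * cos (u * y)) / (e ^+ 2 + y ^+ 2)).
have d0 := cauchy_denom_gt0 y e0.
have dF u : is_derive u 1 F (f u).
  rewrite /F /f; apply: is_derive_eq.
  rewrite /GRing.scale/=.
  by field; rewrite ?gt_eqF.
have cf : continuous f.
  move=> u; rewrite /f; apply: differentiable_continuous; apply/derivable1_diffP.
  by [].
have cF u : {for u, continuous F}.
  by apply: differentiable_continuous; apply/derivable1_diffP; case: (dF u).
rewrite (@ge0_continuous_FTC2y R f F 0 0).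
- rewrite /F mulr0 oppr0 expR0 mul0r sin0 cos0 /cauchy_kernel -EFinB; congr EFin.
  by field; rewrite ?gt_eqF.
- by move=> u _; rewrite mulr_ge0 ?expR_ge0//; have := cos_geN1 (u * y); lra.
- exact: continuous_subspaceT.
(* [C] bounds the second factor of [F] uniformly in [u], so [F] decays like [exp (- e u)]. *)
- pose C := e^-1 + (`|y| + e) / (e ^+ 2 + y ^+ 2).
  have bF u : `|F u| <= expR (- (e * u)) * C.
    rewrite /F normrM ger0_norm ?expR_ge0// ler_wpM2l ?expR_ge0//.
    rewrite (le_trans (ler_normD _ _))// normrN gtr0_norm ?invr_gt0// lerD2l.
    rewrite normrM [X in _ * X]gtr0_norm ?invr_gt0// ler_pM2r ?invr_gt0//.
    rewrite (le_trans (ler_normB _ _))// !normrM (gtr0_norm e0).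
    by apply: lerD; apply: ler_piMr; rewrite ?normr_ge0 ?(ltW e0)// ler_norml
      ?sin_geN1 ?sin_le1 ?cos_geN1 ?cos_le1.
  have cE : expR (- (e * u)) * C @[u --> +oo] --> (0 : R).
    by rewrite -[X in _ --> X](mul0r C); apply: cvgMr_tmp; exact: cvg_expRN.
  apply: (squeeze_cvgr _ _ cE); last first.
    rewrite -[X in _ --> X]oppr0; apply: cvgN; exact: cE.
  by apply: nearW => u; rewrite -ler_norml.
- by move=> u _; case: (dF u).
- by apply: cvg_at_right_filter; exact: cF.
- by move=> u _; rewrite derive1E; exact: derive_val.
Qed.

Lemma integral_expRN e : 0 < e ->
  (\int[lebesgue]_(u in `[0%R, +oo[) (expR (- (e * u)))%:E = (e^-1)%:E)%E.
Proof.
move=> e0.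
have cE : continuous (fun u => expR (- (e * u))).
  by move=> u; apply: differentiable_continuous; apply/derivable1_diffP.
rewrite (@ge0_continuous_FTC2y R _ (fun u => - e^-1 * expR (- (e * u))) 0 0).
- by rewrite mulr0 oppr0 expR0 mulr1 sub0e EFinN oppeK.
- by move=> u _; exact: expR_ge0.
- exact: continuous_subspaceT.
- by rewrite -[X in _ --> X](mulr0 (- e^-1)); apply: cvgMl_tmp; exact: cvg_expRN.
- by [].
- by apply: cvg_at_right_filter; apply: cvgMl_tmp; exact: cE.
- move=> u _; rewrite derive1E; apply: derive_val.
  apply: is_derive_eq; rewrite /GRing.scale/=.
  by field; rewrite ?gt_eqF.
Qed.

Lemma integral_cauchy_kernel e y : 0 < e ->
  (\int[lebesgue]_(z in `[0%R, +oo[) (cauchy_kernel e (y - z))%:E =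
  (pi / 2 + atan (y / e))%:E)%E.
Proof.
move=> e0; pose F z := atan ((z - y) / e).
have dF z : is_derive z 1 F (cauchy_kernel e (y - z)).
  rewrite /F; apply: is_derive_eq.
  have ? := cauchy_denom_gt0 (y - z) e0.
  rewrite /GRing.scale/= /cauchy_kernel.
  by field; rewrite ?gt_eqF//= -sqrrN opprB addrC.
have ck : continuous (fun z => cauchy_kernel e (y - z)).
  move=> z; apply: differentiable_continuous; apply/derivable1_diffP.
  rewrite /cauchy_kernel; apply: derivableM => //; apply: derivableV => //.
  by rewrite gt_eqF// cauchy_denom_gt0.
rewrite (@ge0_continuous_FTC2y R _ F 0 (pi / 2)).
- by rewrite /F sub0r mulNr atanN -EFinB opprK.
- by move=> z _; exact: cauchy_kernel_ge0.
- exact: continuous_subspaceT.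
- apply: (@cvg_comp _ _ _ (fun z => (z - y) / e) (@atan R)); last exact: cvgy_atan.
  apply: gt0_cvgMly; first by rewrite invr_gt0.
  exact: cvg_addrr.
- by move=> z _; case: (dF z).
- apply: cvg_at_right_filter.
  by apply: differentiable_continuous; apply/derivable1_diffP; case: (dF 0).
- by move=> z _; rewrite derive1E; exact: derive_val.
Qed.

End cauchy_kernel.

(** * Bounded random variables and their trigonometric integrals *)

Section bounded_integrable.
Context {R : realType} {d : measure_display} {Omega : measurableType d}.
Variable P : probability Omega R.

Lemma probability_bounded_integrable (f : Omega -> R) (M : R) :
  measurable_fun setT f -> (forall w, `|f w| <= M) ->
  P.-integrable setT (EFin \o f).
Proof.
move=> mf fM; apply: measurable_bounded_integrable => //.
  by apply: (le_lt_trans (probability_le1 P measurableT)); rewrite ltry.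
exists M; split; first exact: num_real.
by move=> x Mx w _; apply: (le_trans (fM w)); exact: ltW.
Qed.

Lemma integral_EFin_Rintegral (f : Omega -> R) :
  P.-integrable setT (EFin \o f) ->
  (\int[P]_w (f w)%:E = (\int[P]_w f w)%R%:E)%E.
Proof. by move=> fi; rewrite /Rintegral fineK//; exact: integrable_fin_num. Qed.

Lemma measurable_cos : measurable_fun [set: R] cos.
Proof. apply: continuous_measurable_fun; exact: continuous_cos. Qed.

Lemma measurable_sin : measurable_fun [set: R] sin.
Proof. apply: continuous_measurable_fun; exact: continuous_sin. Qed.

Lemma measurable_cosM (X : Omega -> R) u : measurable_fun setT X ->
  measurable_fun setT (fun w => cos (u * X w)).
Proof.
by move=> mX; apply: (measurableT_comp measurable_cos); exact: measurable_funM.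
Qed.

Lemma measurable_sinM (X : Omega -> R) u : measurable_fun setT X ->
  measurable_fun setT (fun w => sin (u * X w)).
Proof.
by move=> mX; apply: (measurableT_comp measurable_sin); exact: measurable_funM.
Qed.

Lemma integrable_cosM (X : Omega -> R) u : measurable_fun setT X ->
  P.-integrable setT (EFin \o (fun w => cos (u * X w))).
Proof.
move=> /(measurable_cosM u) mX.
apply: (@probability_bounded_integrable _ 1) => // w.
by rewrite ler_norml cos_geN1 cos_le1.
Qed.

Lemma integrable_sinM (X : Omega -> R) u : measurable_fun setT X ->
  P.-integrable setT (EFin \o (fun w => sin (u * X w))).
Proof.
move=> /(measurable_sinM u) mX.
apply: (@probability_bounded_integrable _ 1) => // w.
by rewrite ler_norml sin_geN1 sin_le1.
Qed.

End bounded_integrable.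
Arguments measurable_cos {R}.
Arguments measurable_sin {R}.

(** * The Cauchy transform of a law in terms of its characteristic function *)

Section cauchy_transform.
Context {R : realType}.
Local Notation lebesgue := (@lebesgue_measure R).

Lemma tonelli_halfline {d : measure_display} {Omega : measurableType d}
    (P : probability Omega R) (f : Omega -> R -> R) :
  measurable_fun setT (fun z : Omega * R => f z.1 z.2) ->
  (forall w u, 0 <= f w u) ->
  (\int[P]_w \int[lebesgue]_(u in `[0%R, +oo[) (f w u)%:E =
   \int[lebesgue]_(u in `[0%R, +oo[) \int[P]_w (f w u)%:E)%E.
Proof.
move=> mf f0.
(* The restriction to the half-line moves into the integrand as an indicator, so that Tonelli
   applies to the full product space. *)
pose D : set R := `[0, +oo[%classic.
pose g (z : Omega * R) : \bar R := (f z.1 z.2 * \1_D z.2)%:E.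
have mg : measurable_fun [set: (Omega * R)%type] g.
  apply/measurable_EFinP; apply: measurable_funM => //.
  apply: measurableT_comp => //; apply: measurable_indic; exact: measurable_itv.
have g0 z : (0 <= g z)%E by rewrite lee_fin mulr_ge0.
transitivity (\int[P]_w \int[lebesgue]_u g (w, u))%E.
  apply: eq_integral => w _; rewrite integral_mkcond; apply: eq_integral => u _.
  by rewrite /g patchE indicE; case: ifPn => _; rewrite ?mulr1 ?mulr0.
rewrite (@fubini_tonelli _ _ Omega (measurableTypeR R) R P lebesgue g mg g0).
rewrite [RHS]integral_mkcond; apply: eq_integral => u _.
rewrite patchE; case: ifPn => uD.
  by apply: eq_integral => w _; rewrite /g indicE uD mulr1.
by apply: integral0_eq => w _; rewrite /g indicE (negbTE uD) mulr0.
Qed.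

Context {d : measure_display} {Omega : measurableType d}.
Variables (P : probability Omega R) (X : Omega -> R).
Hypothesis mX : measurable_fun setT X.

Lemma measurable_cauchy_kernel (e x : R) : 0 < e ->
  measurable_fun setT (fun w => cauchy_kernel e (X w - x)).
Proof.
move=> e0; apply: (measurableT_comp (f := cauchy_kernel e)); last first.
  exact: measurable_funB.
apply: continuous_measurable_fun => y.
rewrite /cauchy_kernel; apply: differentiable_continuous; apply/derivable1_diffP.
apply: derivableM => //; apply: derivableV => //.
by rewrite gt_eqF// cauchy_denom_gt0.
Qed.

(** [integral_exp_cos] is applied at each [X w - x], Tonelli exchanges the integrals, and the
    subtraction formula for cosine separates [X] from [x]. The right side sees the law of [X] only
    through its cosine and sine integrals. *)
Lemma cauchy_transform (e x : R) : 0 < e ->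
  (\int[P]_w (e^-1 + cauchy_kernel e (X w - x))%:E =
   \int[lebesgue]_(u in `[0%R, +oo[)
     (expR (- (e * u)) * (1 + (cos (u * x) * \int[P]_w cos (u * X w)
                    + sin (u * x) * \int[P]_w sin (u * X w))))%R%:E)%E.
Proof.
move=> e0.
under eq_integral do rewrite -integral_exp_cos//.
rewrite tonelli_halfline; last 2 first.
- apply: measurable_funM.
    apply: measurableT_comp => //; apply: measurableT_comp => //.
    exact: measurable_funM.
  apply: measurable_funD => //; apply: (measurableT_comp measurable_cos).
  apply: measurable_funM => //; apply: measurable_funB => //.
  exact: measurableT_comp.
- by move=> w u; rewrite mulr_ge0 ?expR_ge0//; have := cos_geN1 (u * (X w - x)); lra.
apply: eq_integral => u _.
have intc := integrable_cosM P u mX; have ints := integrable_sinM P u mX.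
have i1 : P.-integrable setT (EFin \o cst (1 : R)).
  exact: finite_measure_integrable_cst.
have ics : P.-integrable setT (EFin \o (fun w => cos (u * (X w - x)))).
  by apply: integrable_cosM; exact: measurable_funB.
have i2 : P.-integrable setT (EFin \o (fun w => 1 + cos (u * (X w - x)))).
  exact: (integrableD _ i1 ics).
rewrite integral_EFin_Rintegral; last exact: (integrableZl _ _ i2).
rewrite RintegralZl// RintegralD// Rintegral_cst//.
rewrite [fine (P _)](_ : _ = 1) ?mulr1; last by rewrite probability_setT.
under eq_Rintegral do rewrite mulrBr cosB
  [cos (u * X _) * _]mulrC [sin (u * X _) * _]mulrC.
rewrite RintegralD//; [|exact: (integrableZl _ _ intc)|exact: (integrableZl _ _ ints)].
by rewrite !RintegralZl.
Qed.

End cauchy_transform.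

(** * A smooth approximation of the step function *)

Section smoothed_step.
Context {R : realType}.
Implicit Types e y : R.

(* Converges to [pi] times the indicator of [0 <= y] as [e] tends to 0; the last
   summand lifts the limit at [y = 0] from [pi / 2] to [pi]. *)
Definition smoothed_step e y : R :=
  (pi / 2 + atan (y / e)) + (pi / 2 * e) * cauchy_kernel e y.

Lemma mul_cauchy_kernel_le1 e y : 0 < e -> e * cauchy_kernel e y <= 1.
Proof.
move=> e0; rewrite /cauchy_kernel mulrA ler_pdivrMr ?cauchy_denom_gt0//.
by rewrite mul1r -expr2 lerDl sqr_ge0.
Qed.

(** The bound is uniform in [e], hence serves as the dominating constant when [e] tends to 0. *)
Lemma smoothed_step_bound e y : 0 < e -> `|smoothed_step e y| <= 2 * pi.
Proof.
move=> e0; have p0 : 0 < pi :> R := pi_gt0 R.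
have k0 : 0 <= e * cauchy_kernel e y.
  by rewrite mulr_ge0 ?(ltW e0)// cauchy_kernel_ge0.
have k1 := mul_cauchy_kernel_le1 y e0.
have := atan_gtNpi2 (y / e); have := atan_ltpi2 (y / e).
rewrite /smoothed_step -mulrA => a1 a2.
by rewrite ler_norml; apply/andP; split; nra.
Qed.

Lemma measurable_smoothed_step e : 0 < e -> measurable_fun setT (smoothed_step e).
Proof.
move=> e0; apply: measurable_funD; last first.
  apply: measurable_funM => //.
  by have := @measurable_cauchy_kernel R _ _ idfun (@measurable_id _ _ _) e 0 e0;
    under eq_fun do rewrite subr0.
apply: measurable_funD => //.
apply: (measurableT_comp (f := @atan R)).
  by apply: continuous_measurable_fun => z; exact: continuous_atan.
exact: measurable_funM.
Qed.

Lemma smoothed_step_cvg y :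
  smoothed_step n.+1%:R^-1 y @[n --> \oo] --> pi * (0 <= y)%R%:R.
Proof.
have h0 : n.+1%:R^-1 @[n --> \oo] --> (0 : R) by exact: cvg_harmonic.
(* At [y = 0] the value is exactly [pi] for every [e]: the arctangent part gives [pi / 2], and the
   kernel, equal to [1 / e] there, gives the other half. *)
have [-> |y0] := eqVneq y 0.
  rewrite lexx mulr1; apply: cvg_near_cst; apply: nearW => n.
  rewrite /smoothed_step /cauchy_kernel mul0r atan0 addr0 expr0n /= addr0.
  have : n.+1%:R^-1 != 0 :> R by rewrite invr_eq0 pnatr_eq0.
  by move: (n.+1%:R^-1) => e e0; field.
(* Away from [y = 0] the correction is continuous in [e] up to [e = 0], where it vanishes. *)
have k0 : (pi / 2 * n.+1%:R^-1) * cauchy_kernel n.+1%:R^-1 y @[n --> \oo] --> (0 : R).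
  pose g e := (pi / 2 * e) * cauchy_kernel e y.
  have -> : (0 : R) = g 0 by rewrite /g mulr0 mul0r.
  apply: (cvg_comp _ g h0); apply: differentiable_continuous; apply/derivable1_diffP.
  rewrite /g /cauchy_kernel; apply: derivableM => //; apply: derivableM => //.
  by apply: derivableV => //; rewrite expr0n add0r sqrf_eq0.
have ny : n.+1%:R @[n --> \oo] --> (+oo : set_system R).
  by rewrite (cvg_shiftS (fun n => n%:R : R)); exact: cvgr_idn.
have atany z : 0 < z -> atan (z / n.+1%:R^-1) @[n --> \oo] --> (pi / 2 : R).
  move=> z0.
  have zy : z / n.+1%:R^-1 @[n --> \oo] --> +oo.
    rewrite (_ : (fun n => z / n.+1%:R^-1) = (fun n => z * n.+1%:R)).
      exact: (cvg_comp _ (fun x => z * x) ny (gt0_cvgMry z0 (@cvg_id _ _))). 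
    by apply/funext => n; rewrite invrK.
  apply: (cvg_comp (fun n => z / n.+1%:R^-1) (@atan R) zy); exact: cvgy_atan.
rewrite -[X in _ --> X]addr0; apply: cvgD => //.
have [yn|yp|/eqP] := ltgtP y 0; last by rewrite (negbTE y0).
- rewrite mulr0 -(subrr (pi / 2)); apply: cvgD; first exact: cvg_cst.
  rewrite (_ : (fun n => _) = (fun n => - atan (- y / n.+1%:R^-1))); last first.
    by apply/funext => n; rewrite mulNr atanN opprK.
  by apply: cvgN; apply: atany; rewrite oppr_gt0.
- rewrite mulr1 [X in _ --> X](splitr pi); apply: cvgD; first exact: cvg_cst.
  exact: atany.
Qed.

End smoothed_step.

(** * Cancellation in the extended reals *)

Lemma adde_injl (R : realDomainType) (x : \bar R) :
  x \is a fin_num -> injective (fun y => x + y)%E.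
Proof.
move=> xf y z /= E; apply: le_anti.
by rewrite -(leeD2lE y z xf) -(leeD2lE z y xf) E lexx.
Qed.

Lemma mule_injl (R : realFieldType) (x : \bar R) :
  x \is a fin_num -> (0 < x)%E -> injective (fun y => x * y)%E.
Proof.
move=> xf x0 y z /= E; apply: le_anti.
by rewrite -(lee_pmul2l xf x0 y z) -(lee_pmul2l xf x0 z y) E lexx.
Qed.

(** * Recovery of the tails from the characteristic function *)

Section inversion.
Context {R : realType}.
Local Notation lebesgue := (@lebesgue_measure R).

Section smoothing.
Context {d : measure_display} {Omega : measurableType d}.
Variables (P : probability Omega R) (X : Omega -> R).
Hypothesis mX : measurable_fun setT X.

Lemma integral_addr_cauchy_kernel (e x : R) : 0 < e ->
  (\int[P]_w (e^-1 + cauchy_kernel e (X w - x))%:E =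
   (e^-1)%:E + \int[P]_w (cauchy_kernel e (X w - x))%:E)%E.
Proof.
move=> e0; under eq_integral do rewrite EFinD.
rewrite ge0_integralD//.
- rewrite integral_cst// [X in (_ * X + _)%E](_ : _ = 1%E) ?mule1//.
  exact: probability_setT.
- by move=> w _; rewrite lee_fin invr_ge0 ltW.
- by move=> w _; rewrite lee_fin cauchy_kernel_ge0.
- by apply/measurable_EFinP; exact: measurable_cauchy_kernel.
Qed.

(** The arctangent part of [smoothed_step] is the integral of the kernel over shifts [z >= 0]
    ([integral_cauchy_kernel]). After Tonelli, only the expected kernels at the points [a + z] and
    [a] remain. *)
Lemma integral_smoothed_step (e a : R) : 0 < e ->
  (\int[P]_w (smoothed_step e (X w - a))%:E =
   \int[lebesgue]_(z in `[0%R, +oo[)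
     \int[P]_w (cauchy_kernel e (X w - (a + z)))%:E +
   (pi / 2 * e)%:E * \int[P]_w (cauchy_kernel e (X w - a))%:E)%E.
Proof.
move=> e0; have pie0 : 0 <= pi / 2 * e :> R.
  by rewrite mulr_ge0 ?ltW// divr_gt0 ?pi_gt0.
have mk : measurable_fun setT (fun y : R => cauchy_kernel e y).
  by have := @measurable_cauchy_kernel R _ _ idfun (@measurable_id _ _ _) e 0 e0;
    under eq_fun do rewrite subr0.
transitivity (\int[P]_w \int[lebesgue]_(z in `[0%R, +oo[)
    (cauchy_kernel e (X w - a - z))%:E +
  \int[P]_w ((pi / 2 * e)%:E * (cauchy_kernel e (X w - a))%:E))%E.
  under [X in (X + _)%E]eq_integral do rewrite integral_cauchy_kernel//.
  rewrite -ge0_integralD//.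
  - by move=> w _; rewrite lee_fin; have := atan_gtNpi2 ((X w - a) / e); lra.
  - apply/measurable_EFinP; apply: measurable_funD => //.
    apply: (measurableT_comp (f := @atan R)).
      by apply: continuous_measurable_fun => z; exact: continuous_atan.
    by apply: measurable_funM => //; exact: measurable_funB.
  - by move=> w _; rewrite lee_fin mulr_ge0// cauchy_kernel_ge0.
  - apply/measurable_EFinP; apply: measurable_funM => //.
    exact: measurable_cauchy_kernel.
rewrite tonelli_halfline; last 2 first.
- apply: (measurableT_comp mk); apply: measurable_funB => //.
  by apply: measurable_funB => //; exact: measurableT_comp.
- by move=> w z; exact: cauchy_kernel_ge0.
congr adde.
  by apply: eq_integral => z _; apply: eq_integral => w _; rewrite opprD addrA.
rewrite ge0_integralZl_EFin//.
- by move=> w _; rewrite lee_fin cauchy_kernel_ge0.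
- by apply/measurable_EFinP; exact: measurable_cauchy_kernel.
Qed.

Lemma integral_smoothed_step_cvg (a : R) :
  (\int[P]_w (smoothed_step n.+1%:R^-1 (X w - a))%:E)%E @[n --> \oo] -->
  (pi%:E * P [set w | (a <= X w)%R])%E.
Proof.
have mA : measurable [set w | a <= X w].
  rewrite (_ : [set w | _] = X @^-1` `[a, +oo[).
    by rewrite -[_ @^-1` _]setTI; apply: mX => //; exact: measurable_itv.
  by apply/seteqP; split=> w /=; rewrite in_itv/= andbT.
have -> : (pi%:E * P [set w | (a <= X w)%R] =
    \int[P]_w (pi * \1_[set w | (a <= X w)%R] w)%:E)%E.
  under eq_integral do rewrite EFinM.
  rewrite ge0_integralZl_EFin//; last exact: pi_ge0.
  - by rewrite integral_indic// setIT.
  - by apply/measurable_EFinP; exact: measurable_indic.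
have [] := @dominated_convergence _ _ _ P setT measurableT
  (fun n w => (smoothed_step n.+1%:R^-1 (X w - a))%:E)
  (fun w => (pi * \1_[set w | (a <= X w)%R] w)%:E)
  (fun=> (2 * pi)%:E).
- move=> n; apply/measurable_EFinP.
  apply: (measurableT_comp (measurable_smoothed_step _)) => //.
  exact: measurable_funB.
- by apply/measurable_EFinP; apply: measurable_funM.
- apply: aeW => w _; apply: cvg_EFin; first exact: nearW.
  have := @smoothed_step_cvg R (X w - a); rewrite subr_ge0 indicE.
  by rewrite (_ : (a <= X w) = (w \in [set w | a <= X w]))//; apply/idP/idP;
    rewrite inE.
- exact: finite_measure_integrable_cst.
- by apply: aeW => w n _; rewrite /= lee_fin; exact: smoothed_step_bound.
by move=> _ _.
Qed.

End smoothing.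

(** Equal cosine and sine integrals give equal expected kernels at every point, hence equal expected
    smoothed steps for every [e > 0]. Both sides converge to [pi] times the tail probabilities, and
    [pi] cancels. *)
Lemma upper_halfline_prob_eq
    {d1 d2 : measure_display} {O1 : measurableType d1} {O2 : measurableType d2}
    (P : probability O1 R) (Q : probability O2 R) (X : O1 -> R) (Y : O2 -> R) :
  measurable_fun setT X -> measurable_fun setT Y ->
  (forall u, \int[P]_w cos (u * X w) = \int[Q]_w cos (u * Y w)) ->
  (forall u, \int[P]_w sin (u * X w) = \int[Q]_w sin (u * Y w)) ->
  forall a : R, P [set w | a <= X w] = Q [set w | a <= Y w].
Proof.
move=> mX mY Ec Es a.
have Ek e x : 0 < e -> (\int[P]_w (cauchy_kernel e (X w - x))%:E =
    \int[Q]_w (cauchy_kernel e (Y w - x))%:E)%E.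
  (* [cauchy_transform] computes the kernel augmented by [e^-1], so this summand is added to both
     sides. *)
  move=> e0; apply: (@adde_injl _ (e^-1)%:E) => //.
  rewrite -!integral_addr_cauchy_kernel// !cauchy_transform//.
  by apply: eq_integral => u _; rewrite Ec Es.
have Eg e : 0 < e -> (\int[P]_w (smoothed_step e (X w - a))%:E =
    \int[Q]_w (smoothed_step e (Y w - a))%:E)%E.
  move=> e0; rewrite !integral_smoothed_step// Ek//; congr adde.
  by apply: eq_integral => z _; exact: Ek.
have := @integral_smoothed_step_cvg _ _ P X mX a.
under eq_fun do rewrite Eg//.
have cQ := @integral_smoothed_step_cvg _ _ Q Y mY a.
move=> cP; apply: (@mule_injl _ pi%:E) => //=; first by rewrite lte_fin pi_gt0.
exact: (cvg_unique _ cP cQ).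
Qed.

End inversion.

(** * Absence of atoms for symmetric stable laws *)

Section atom.
Context {R : realType} {d : measure_display} {Omega : measurableType d}.
Variables (P : probability Omega R) (X : Omega -> R).
Hypothesis mX : measurable_fun setT X.
Local Notation lebesgue := (@lebesgue_measure R).

Lemma measurable_eq_cst (x : R) : measurable [set w | X w = x].
Proof.
rewrite (_ : [set w | _] = X @^-1` [set x])//.
by rewrite -[_ @^-1` _]setTI; apply: mX.
Qed.

(** The kernel equals [e^-1] at 0 and is nonnegative elsewhere, so it dominates [e^-1] times the
    indicator of [X = x]. *)
Lemma atom_le_cauchy (e x : R) : 0 < e ->
  ((e^-1)%:E * P [set w | X w = x] <= \int[P]_w (cauchy_kernel e (X w - x))%:E)%E.
Proof.
move=> e0; have mA := measurable_eq_cst x.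
have -> : P [set w | X w = x] =
    (\int[P]_w (\1_[set w | X w = x] w)%:E)%E by rewrite integral_indic// setIT.
rewrite -ge0_integralZl_EFin//; last by rewrite invr_ge0 ltW.
- apply: ge0_le_integral => //.
  + by move=> w _; rewrite -EFinM lee_fin mulr_ge0// invr_ge0 ltW.
  + by apply/measurable_EFinP; apply: measurable_funM.
  + by apply/measurable_EFinP; exact: measurable_cauchy_kernel.
  + move=> w _; rewrite -EFinM lee_fin indicE.
    have [/set_mem /= ->|_] := boolP (w \in _); last first.
      by rewrite mulr0 cauchy_kernel_ge0.
    by rewrite subrr /cauchy_kernel expr0n /= addr0 mulr1 expr2 invfM
      mulrA divff ?mul1r// gt_eqF.
- exact/measurable_EFinP/measurable_indic.
Qed.

Variables (g p : R).
Hypotheses (g0 : 0 < g) (p0 : 0 < p).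
Hypothesis Ecos : forall u, \int[P]_w cos (u * X w) = expR (- (g * `|u| `^ p)).
Hypothesis Esin : forall u, \int[P]_w sin (u * X w) = 0.

(** The frequencies are split at [K]. Below [K] the characteristic function is at most 1, which
    costs [K]; above [K] it is at most [exp (- g K^p)], which costs this times the integral [e^-1]
    of [exp (- e u)]. *)
Lemma integral_cauchy_kernel_le (e K x : R) : 0 < e -> 0 < K ->
  (\int[P]_w (cauchy_kernel e (X w - x))%:E <=
   (K + expR (- (g * K `^ p)) * e^-1)%:E)%E.
Proof.
move=> e0 K0; set q := expR _.
rewrite -(@leeD2lE _ (e^-1)%:E)// -integral_addr_cauchy_kernel// cauchy_transform//.
pose D : set R := `[0%R, K]%classic.
have mD : measurable D by exact: measurable_itv.
(* The bound is itself written as the integral of a majorant, so that a pointwise comparison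
   finishes the proof. *)
have -> : ((e^-1)%:E + (K + q * e^-1)%:E =
  \int[lebesgue]_(u in `[0%R, +oo[) ((1 + q)%:E * (expR (- (e * u)))%:E + (\1_D u)%:E))%E.
  rewrite ge0_integralD//=.
  - rewrite ge0_integralZl_EFin//=.
    + rewrite integral_expRN// integral_indic//=.
      rewrite setIidl; last by move=> u; rewrite /D /= !in_itv/= => /andP[->].
      rewrite /D lebesgue_measure_itv/= lte_fin K0 -EFinB -!EFinM -!EFinD subr0.
      by congr EFin; ring.
    + by apply/measurable_EFinP; do 2 apply: measurableT_comp => //; exact: measurable_funM.
    + by rewrite addr_ge0// expR_ge0.
  - by move=> u _; rewrite -EFinM lee_fin mulr_ge0 ?expR_ge0// addr_ge0 ?expR_ge0.
  - apply/measurable_EFinP; apply: measurable_funM => //.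
    by do 2 apply: measurableT_comp => //; exact: measurable_funM.
  - exact/measurable_EFinP/measurable_indic.
have phi1 (u : R) : expR (- (g * `|u| `^ p)) <= 1.
  by rewrite -[leRHS]expR0 ler_expR oppr_le0 mulr_ge0 ?powR_ge0// ltW.
have bnd (u : R) : 0 <= u -> cos (u * x) * expR (- (g * `|u| `^ p)) <= q + \1_D u.
  move=> u0; apply: (@le_trans _ _ (expR (- (g * `|u| `^ p)))).
    by rewrite ler_piMl ?expR_ge0// cos_le1.
  rewrite indicE; have [uD|uD] := boolP (u \in D).
    by rewrite (le_trans (phi1 u))// lerDr expR_ge0.
  rewrite addr0 ler_expR lerN2 ler_pM2l// ger0_norm//.
  rewrite ge0_ler_powR ?nnegrE ?(ltW p0) ?(ltW K0)//.
  move: uD; apply: contraNT; rewrite -ltNge => uK.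
  by rewrite inE /D /= in_itv/= u0 ltW.
under eq_integral do rewrite Ecos Esin mulr0 addr0.
apply: ge0_le_integral => //=.
- move=> u _; rewrite lee_fin mulr_ge0 ?expR_ge0// -lerBlDl sub0r.
  have : `|cos (u * x) * expR (- (g * `|u| `^ p))| <= 1.
    rewrite normrM mulr_ile1// ?(ger0_norm (expR_ge0 _))// ler_norml.
    by rewrite cos_geN1 cos_le1.
  by rewrite ler_norml => /andP[].
- apply/measurable_EFinP; apply: measurable_funM.
    by do 2 apply: measurableT_comp => //; exact: measurable_funM.
  apply: measurable_funD => //; apply: measurable_funM.
    by apply: (measurableT_comp measurable_cos) => //; exact: measurable_funM.
  do 2 apply: measurableT_comp => //; apply: measurable_funM => //.
  by apply: (measurableT_comp (measurable_powR _)) => //; exact: measurableT_comp.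
- apply/measurable_EFinP; apply: measurable_funD.
    apply: measurable_funM => //.
    by do 2 apply: measurableT_comp => //; exact: measurable_funM.
  exact: measurable_indic.
- move=> u; rewrite /= in_itv/= andbT => u0.
  rewrite -EFinM -EFinD lee_fin.
  have e1 : expR (- (e * u)) <= 1.
    by rewrite -[leRHS]expR0 ler_expR oppr_le0 mulr_ge0// ltW.
  have i0 : 0 <= \1_D u :> R by [].
  have := bnd u u0; have := expR_ge0 (- (e * u)).
  move: (\1_D u) (cos _ * _) (expR (- (e * u))) i0 e1 => i c E i0 E1 E0 cqi.
  have : E * c <= E * (q + i) by rewrite ler_wpM2l.
  by nra.
Qed.

Lemma stable_no_atom (x : R) : P [set w | X w = x] = 0%E.
Proof.
have mA := measurable_eq_cst x.
set m := fine (P [set w | X w = x]).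
have mE : P [set w | X w = x] = m%:E by rewrite fineK// fin_num_measure.
have m0 : 0 <= m by rewrite fine_ge0.
have main (e K : R) : 0 < e -> 0 < K -> m <= e * K + expR (- (g * K `^ p)).
  move=> e0 K0; have := le_trans (atom_le_cauchy x e0)
    (integral_cauchy_kernel_le x e0 K0).
  rewrite mE -EFinM lee_fin mulrC ler_pdivrMr// mulrDl mulfVK ?gt_eqF//.
  by rewrite [K * e]mulrC.
rewrite mE; congr EFin; apply/eqP; rewrite eq_le m0 andbT.
apply/ler_addgt0Pl => dl dl0; rewrite addr0.
(* Since [exp T >= T], this [T] gives [exp (- T) <= dl / 2]. [K] solves [g K^p = T], and then
   [e = dl / 2 / K] makes the other term [dl / 2]. *)
pose T := 2 / dl; have T0 : 0 < T by rewrite divr_gt0.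
pose K := (T / g) `^ p^-1.
have K0 : 0 < K by rewrite powR_gt0// divr_gt0.
have KT : g * K `^ p = T.
  rewrite /K -powRrM mulVf ?gt_eqF// powRr1 ?(ltW (divr_gt0 T0 g0))//.
  by rewrite mulrC mulfVK ?gt_eqF.
have eT : expR (- T) <= dl / 2.
  rewrite expRN -[dl / 2]invrK lef_pV2 ?posrE ?invr_gt0 ?divr_gt0 ?expR_gt0//.
  rewrite invf_div -/T; apply: le_trans (expR_ge1Dx T).
  by rewrite lerDr.
have := main (dl / 2 / K) K; rewrite KT mulfVK ?gt_eqF// => /(_ _ K0) mb.
rewrite (le_trans (mb _))// ?divr_gt0//.
by rewrite [leRHS](splitr dl) lerD2l.
Qed.

End atom.

(** * Independence of pairs and of partial sums *)

Lemma measurable_preimage {d d'} {T : measurableType d} {T' : measurableType d'}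
    (f : T -> T') A :
  measurable_fun setT f -> measurable A -> measurable (f @^-1` A).
Proof. by move=> mf mA; rewrite -[_ @^-1` _]setTI; exact: mf. Qed.

Section independent_sums.
Context {R : realType} {d : measure_display} {Omega : measurableType d}.
Variable P : probability Omega R.

(** A pi-system argument: both sides are finite measures in [C], namely the law of [(U, V)] under
    [P] restricted to [F], and [P F] times the law of [(U, V)]. They agree on measurable rectangles,
    which are stable under intersection and generate the product sigma-algebra. *)
Lemma indep_pair_event (U V : Omega -> R) (F : set Omega) :
  measurable_fun setT U -> measurable_fun setT V -> measurable F ->
  (forall A D, measurable A -> measurable D ->
    P (U @^-1` A `&` V @^-1` D `&` F) = (P (U @^-1` A `&` V @^-1` D) * P F)%E) ->
  forall C : set (R * R), measurable C ->
    P ((fun w => (U w, V w)) @^-1` C `&` F) =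
    (P ((fun w => (U w, V w)) @^-1` C) * P F)%E.
Proof.
move=> mU mV mF UVF C mC.
pose W w := (U w, V w).
have mW : measurable_fun setT W by exact: measurable_fun_pair.
pose W' : {mfun Omega >-> (R * R)%type} := HB.pack W (isMeasurableFun.Build _ _ _ _ _ mW).
pose m1' : {measure set (R * R)%type -> \bar R} := pushforward (mrestr P mF) W'.
pose m1 := m1' mW.
pose r : {nonneg R} := NngNum (fine_ge0 (measure_ge0 P F)).
pose m2 : {measure set (R * R)%type -> \bar R} := mscale r (distribution P W').
have PF : P F = (r%:num)%:E by rewrite /r /= fineK// fin_num_measure.
pose G : set (set (R * R)) := [set A `*` D | A in measurable & D in measurable].
have m12 : forall A, G A -> m1 A = m2 A.
  move=> _ [A mA [D mD <-]].
  rewrite /m1 /m1' /m2 /= /mscale /distribution /pushforward /mrestr /=.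
  rewrite -PF muleC.
  have -> : W @^-1` (A `*` D) = U @^-1` A `&` V @^-1` D by [].
  exact: UVF.
have := @measure_unique _ _ _ G (fun=> setT) _ _ _ _ m1 m2 m12 _ C mC.
rewrite /m1 /m1' /m2 /= /mscale /distribution /pushforward /mrestr /= -PF muleC; apply.
- by rewrite measurable_prod_measurableType.
- move=> _ _ [A mA [D mD <-]] [A' mA' [D' mD' <-]].
  exists (A `&` A'); first exact: measurableI.
  by exists (D `&` D'); [exact: measurableI|rewrite setXI].
- by move=> _; exists setT => //; exists setT => //; rewrite setXTT.
- by rewrite bigcup_const.
- move=> _; rewrite preimage_setT setTI.
  by rewrite (le_lt_trans (probability_le1 P mF))// ltry.
Qed.

Definition indep_pair (U V : Omega -> R) :=
  forall A D : set R, measurable A -> measurable D ->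
    P (U @^-1` A `&` V @^-1` D) = (P (U @^-1` A) * P (V @^-1` D))%E.

(** Independence identifies the joint law with the product of the marginal laws, and Fubini factors
    the integral. Boundedness of [f] and [g] provides the integrability. *)
Lemma indep_pair_Rintegral (U V : Omega -> R) (f g : R -> R) (M N : R) :
  measurable_fun setT U -> measurable_fun setT V -> indep_pair U V ->
  measurable_fun setT f -> measurable_fun setT g ->
  (forall x, `|f x| <= M) -> (forall x, `|g x| <= N) ->
  \int[P]_w (f (U w) * g (V w)) = \int[P]_w f (U w) * \int[P]_w g (V w).
Proof.
move=> mU mV UV mf mg fM gN.
pose W w := (U w, V w).
have mW : measurable_fun setT W by exact: measurable_fun_pair.
pose U' : {mfun Omega >-> R} := HB.pack U (isMeasurableFun.Build _ _ _ _ _ mU).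
pose V' : {mfun Omega >-> R} := HB.pack V (isMeasurableFun.Build _ _ _ _ _ mV).
pose W' : {mfun Omega >-> (R * R)%type} := HB.pack W (isMeasurableFun.Build _ _ _ _ _ mW).
have lawW : forall C : set (R * R), measurable C ->
    ((distribution P U') \x (distribution P V'))%E C = distribution P W' C.
  by apply: product_measure_unique => A D mA mD; exact: UV.
have ifU : P.-integrable setT (EFin \o (f \o U)).
  apply: (@probability_bounded_integrable _ _ _ P _ M) => //=.
  exact: measurableT_comp.
have igV : P.-integrable setT (EFin \o (g \o V)).
  apply: (@probability_bounded_integrable _ _ _ P _ N) => //=.
  exact: measurableT_comp.
pose h (z : R * R) : \bar R := (f z.1 * g z.2)%:E.
have mh : measurable_fun setT h.
  apply/measurable_EFinP; apply: measurable_funM; exact: measurableT_comp.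
have ih : P.-integrable setT (h \o W').
  apply: (@probability_bounded_integrable _ _ _ P
     (fun w => f (U w) * g (V w)) (M * N)) => //=.
  - by apply: measurable_funM; exact: measurableT_comp.
  - by move=> w; rewrite normrM ler_pM.
have ihd : (distribution P W').-integrable setT h.
  exact: integrable_pushforward.
have ihp : ((distribution P U') \x (distribution P V'))%E.-integrable setT h.
  apply/integrableP; split => //; rewrite (eq_measure_integral (distribution P W')).
    by have /integrableP[] := ihd.
  by move=> A mA _; exact: lawW.
apply: EFin_inj; rewrite -integral_EFin_Rintegral//.
rewrite -(integral_distribution mh ih).
transitivity (\int[(distribution P U') \x (distribution P V')]_z h z)%E.
  by apply: eq_measure_integral => A mA _; exact/esym/lawW.
rewrite -integral12_prod_meas1// /fubini_F /h /=.
have mfE : measurable_fun setT (EFin \o f) by exact/measurable_EFinP.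
have mgE : measurable_fun setT (EFin \o g) by exact/measurable_EFinP.
have ifd : (distribution P U').-integrable setT (EFin \o f).
  exact: (integrable_pushforward mU mfE).
have igd : (distribution P V').-integrable setT (EFin \o g).
  exact: (integrable_pushforward mV mgE).
have EV : (\int[distribution P V']_y (g y)%:E = (\int[P]_w g (V w))%:E)%E.
  rewrite (integral_distribution (X := V') mgE igV).
  exact: integral_EFin_Rintegral.
transitivity (\int[distribution P U']_x ((\int[P]_w g (V w))%:E * (f x)%:E))%E.
  apply: eq_integral => x _.
  under eq_integral do rewrite EFinM.
  rewrite integralZl//.
  by rewrite EV muleC.
rewrite integralZl//.
rewrite (integral_distribution (X := U') mfE ifU).
rewrite [X in (_ * X)%E]integral_EFin_Rintegral//.
by rewrite -EFinM mulrC.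
Qed.

Section mutual.
Variables (Y : nat -> Omega -> R) (l : nat -> R).
Hypothesis mY : forall k, measurable_fun setT (Y k).
Hypothesis indepY : mutually_independent P Y.

Definition partial_sum n w := \sum_(k < n) l k * Y k w.

Lemma partial_sumS n w : partial_sum n.+1 w = partial_sum n w + l n * Y n w.
Proof. by rewrite /partial_sum big_ord_recr. Qed.

Lemma measurable_partial_sum n : measurable_fun setT (partial_sum n).
Proof.
elim: n => [|n IH].
  by rewrite (_ : partial_sum 0 = cst 0)//; apply/funext => w; rewrite /partial_sum big_ord0.
rewrite (_ : partial_sum n.+1 = fun w => partial_sum n w + l n * Y n w); last first.
  by apply/funext => w; rewrite partial_sumS.
by apply: measurable_funD => //; exact: measurable_funM.
Qed.

Let cyl (J : {fset nat}) (A : nat -> set R) := \bigcap_(j in [set` J]) Y j @^-1` A j.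

Lemma measurable_cylinder (J : {fset nat}) A :
  (forall j, j \in J -> measurable (A j)) -> measurable (cyl J A).
Proof.
move=> mA; apply: fin_bigcap_measurable => [|j jJ]; first exact: finite_fset.
by apply: measurable_preimage => //; exact: mA.
Qed.

Lemma cylinderU1 n (J : {fset nat}) (A : nat -> set R) (D : set R) :
  n \notin J -> cyl (n |` J)%fset (fun j => if j == n then D else A j) =
  Y n @^-1` D `&` cyl J A.
Proof.
move=> nJ; apply/seteqP; split=> w.
- move=> h; split.
    by have := h n; rewrite /= !inE eqxx; exact.
  move=> j /= jJ; have := h j; rewrite /= !inE jJ orbT.
  have [jn|_] := eqVneq j n; first by rewrite -jn jJ in nJ.
  exact.
- move=> [hn hJ] j /=; rewrite !inE => /predU1P[->|jJ]; first by rewrite eqxx.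
  have [jn|_] := eqVneq j n; first by rewrite -jn jJ in nJ.
  exact: hJ.
Qed.

Lemma cylinderU1_indep n (J : {fset nat}) (A : nat -> set R) (D : set R) :
  n \notin J -> measurable D -> (forall j, j \in J -> measurable (A j)) ->
  P (Y n @^-1` D `&` cyl J A) = (P (Y n @^-1` D) * P (cyl J A))%E.
Proof.
move=> nJ mD mA; rewrite -cylinderU1// /cyl !indepY//; last first.
  move=> j; rewrite !inE => /predU1P[->|jJ]; first by rewrite eqxx.
  by case: ifP => // _; exact: mA.
rewrite big_fsetU1//= eqxx; congr mule.
rewrite big_seq [RHS]big_seq; apply: eq_bigr => j jJ.
by have [jn|//] := eqVneq j n; rewrite -jn jJ in nJ.
Qed.

(** The induction needs whole cylinders over indices at least [n], not just one later variable: in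
    the step, [Y n] joins the cylinder, and the hypothesis for [n] applies to the enlarged
    cylinder. *)
Lemma partial_sum_indep_cylinder n (J : {fset nat}) (A : nat -> set R) (D : set R) :
  (forall j, j \in J -> (n <= j)%N) -> measurable D ->
  (forall j, j \in J -> measurable (A j)) ->
  P (partial_sum n @^-1` D `&` cyl J A) =
  (P (partial_sum n @^-1` D) * P (cyl J A))%E.
Proof.
elim: n J A D => [|n IH] J A D Jn mD mA.
  have S0 w : partial_sum 0 w = 0 by rewrite /partial_sum big_ord0.
  have [D0|D0] := pselect (D 0).
    have -> : partial_sum 0 @^-1` D = setT.
      by apply/seteqP; split=> // w _ /=; rewrite S0.
    by rewrite setTI probability_setT mul1e.
  have -> : partial_sum 0 @^-1` D = set0.
    by apply/seteqP; split=> // w /=; rewrite S0.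
  by rewrite set0I !measure0 mul0e.
have nJ : n \notin J by apply/negP => /Jn; rewrite ltnn.
have mS := measurable_partial_sum n.
have mF := measurable_cylinder mA.
(* The next partial sum is a function of the pair formed by the current one and [Y n], so by
   [indep_pair_event] only rectangles need checking. *)
pose C : set (R * R) := (fun z => z.1 + l n * z.2) @^-1` D.
have mC : measurable C.
  apply: (measurable_preimage _ mD).
  by apply: measurable_funD => //; apply: measurable_funM => //.
have SC : partial_sum n.+1 @^-1` D = (fun w => (partial_sum n w, Y n w)) @^-1` C.
  by apply/seteqP; split=> w; rewrite /= /C /= partial_sumS.
rewrite SC; apply: indep_pair_event => // B E mB mE.
rewrite -setIA -cylinderU1// IH//; last 2 first.
- by move=> j; rewrite !inE => /predU1P[->//|/Jn /ltnW].
- move=> j; rewrite !inE => /predU1P[->|jJ]; first by rewrite eqxx.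
  by case: ifP => // _; exact: mA.
rewrite cylinderU1// cylinderU1_indep//.
(* A second use of the induction hypothesis, on the one-coordinate cylinder at [n], recombines the
   two factors into the probability of the rectangle. *)
have := IH [fset n]%fset (fun=> E) B.
rewrite /cyl set_fset1 bigcap_set1 => -> //; last 1 first.
  by move=> j; rewrite inE => /eqP ->.
by rewrite muleA.
Qed.

Lemma partial_sum_indep n : indep_pair (partial_sum n) (Y n).
Proof.
move=> A D mA mD; have := @partial_sum_indep_cylinder n [fset n]%fset (fun=> D) A.
rewrite /cyl set_fset1 bigcap_set1; apply => //.
by move=> j; rewrite inE => /eqP ->.
Qed.

End mutual.
End independent_sums.

(** * Duality between the coefficient norm and [seq_norm] *)

Section dual_norm.
Context {R : realType}.
Implicit Types (b y : nat -> R) (p q x : R).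

(** Induction from the two-term inequality [hoelder2], with the norms of the first [n] terms as one
    coordinate and the new term as the other. *)
Lemma hoelder_sum n b y p q : 0 < p -> 0 < q -> p^-1 + q^-1 = 1 ->
  \sum_(k < n) `|b k| * `|y k| <=
  (\sum_(k < n) `|b k| `^ p) `^ p^-1 * (\sum_(k < n) `|y k| `^ q) `^ q^-1.
Proof.
move=> p0 q0 pq; elim: n => [|n IH]; first by rewrite !big_ord0 mulr_ge0 ?powR_ge0.
rewrite !big_ord_recr /=.
have powRVK r s : 0 < r -> 0 <= s -> (s `^ r^-1) `^ r = s :> R.
  by move=> r0 s0; rewrite -powRrM mulVf ?gt_eqF// powRr1.
have sum_ge0 (f : nat -> R) r : 0 <= \sum_(k < n) `|f k| `^ r.
  by apply: sumr_ge0 => k _; exact: powR_ge0.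
apply: (le_trans (lerD IH (lexx _))).
(* Each old sum is written as a power of its own root, which gives the right side the two-term
   shape. *)
rewrite -{2}(powRVK p (\sum_(k < n) `|b k| `^ p))//.
rewrite -{2}(powRVK q (\sum_(k < n) `|y k| `^ q))//.
by apply: hoelder2; rewrite ?powR_ge0.
Qed.

(** After division by the right side [s], each ratio [t] lies in [[0, 1]], where [t <= t^p] because
    [p <= 1], and the powers sum to 1. *)
Lemma sum_le_powR_sum n b p : 0 < p -> p <= 1 -> 0 < \sum_(k < n) `|b k| `^ p ->
  \sum_(k < n) `|b k| <= (\sum_(k < n) `|b k| `^ p) `^ p^-1.
Proof.
move=> p0 p1; set N := \sum_(k < n) _ => N0; set s := _ `^ p^-1.
have s0 : 0 < s by rewrite powR_gt0.
have sp : s `^ p = N by rewrite /s -powRrM mulVf ?gt_eqF// powRr1// ltW.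
rewrite -[leRHS]mul1r -ler_pdivrMr// mulr_suml.
rewrite (_ : 1 = \sum_(k < n) `|b k| `^ p / N); last by rewrite -mulr_suml divff// gt_eqF.
apply: ler_sum => k _.
have [->|bk0] := eqVneq (b k) 0; first by rewrite normr0 mul0r divr_ge0 ?powR_ge0// ltW.
have nb0 : 0 < `|b k| by rewrite normr_gt0.
have bs : `|b k| <= s.
  rewrite -[leLHS]powRr1// -(mulfV (lt0r_neq0 p0)) powRrM.
  rewrite ge0_ler_powR ?nnegrE ?powR_ge0 ?invr_ge0 ?(ltW p0) ?(ltW N0)//.
  rewrite /N (bigD1 k)//= lerDl; apply: sumr_ge0 => j _; exact: powR_ge0.
have t0 : 0 < `|b k| / s by rewrite divr_gt0.
have tp : (`|b k| / s) `^ p * N = `|b k| `^ p.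
  by rewrite -sp -powRM ?(ltW t0) ?(ltW s0)// mulfVK ?gt_eqF.
rewrite ler_pdivlMr// -tp ler_pM2r// ger1_powR// t0 /=.
by rewrite ler_pdivrMr// mul1r.
Qed.

Lemma depth_exponentE p : 1 < p -> depth_exponent p = (p / (p - 1))%:E.
Proof.
move=> p1; rewrite /depth_exponent leNgt p1 /= /hoelder_conjugate /=.
rewrite eqe gt_eqF ?(lt_trans ltr01)// -EFinB inver subr_eq0 gt_eqF//.
Qed.

Lemma depth_conjugate p : 1 < p -> p^-1 + (p / (p - 1))^-1 = 1.
Proof.
move=> p1; have p0 : p != 0 by rewrite gt_eqF// (lt_trans ltr01).
have : p - 1 != 0 by rewrite subr_eq0 gt_eqF.
by move=> pN; field; rewrite p0 pN.
Qed.

(** For [p <= 1] the supremum of the [|y k|] is factored out and [sum_le_powR_sum] bounds the rest.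
    For [1 < p] finite Hoelder applies, and partial sums are bounded by the series. *)
Lemma pairing_le_seq_norm p n b y : 0 < p -> 0 < \sum_(k < n) `|b k| `^ p ->
  (((\sum_(k < n) b k * y k) / (\sum_(k < n) `|b k| `^ p) `^ p^-1)%:E <=
   seq_norm (depth_exponent p) y)%E.
Proof.
move=> p0; set N := \sum_(k < n) `|b k| `^ p => N0.
have s0 : 0 < N `^ p^-1 by rewrite powR_gt0.
have absle : \sum_(k < n) b k * y k <= \sum_(k < n) `|b k| * `|y k|.
  by apply: ler_sum => k _; rewrite -normrM ler_norm.
have [p1|p1] := leP p 1.
  rewrite /depth_exponent p1 /=.
  case E : (ereal_sup _) => [m| |].
  - rewrite lee_fin ler_pdivrMr// (le_trans absle)//.
    have ym k : `|y k| <= m.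
      by rewrite -lee_fin -E; apply: ereal_sup_ubound; exists k.
    have m0 : 0 <= m by exact: le_trans (ym 0).
    apply: (@le_trans _ _ (\sum_(k < n) `|b k| * m)).
      by apply: ler_sum => k _; rewrite ler_wpM2l.
    by rewrite -mulr_suml mulrC ler_wpM2l// sum_le_powR_sum.
  - by rewrite leey.
  - have : (`|y 0%N|%:E <= -oo)%E by rewrite -E; apply: ereal_sup_ubound; exists 0%N.
    by rewrite leeNy_eq.
rewrite depth_exponentE//; set q := p / (p - 1).
have q0 : 0 < q by rewrite divr_gt0// subr_gt0.
rewrite /seq_norm.
apply: (@le_trans _ _ ((\sum_(k < n) `|y k| `^ q) `^ q^-1)%:E).
  rewrite lee_fin ler_pdivrMr// mulrC (le_trans absle)// hoelder_sum//.
  exact: depth_conjugate.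
rewrite -poweR_EFin; apply: gt0_ler_poweR.
- by rewrite invr_ge0 ltW.
- by rewrite in_itv/= leey andbT lee_fin; apply: sumr_ge0 => k _; exact: powR_ge0.
- rewrite in_itv/= leey andbT; apply: nneseries_ge0 => k _ _.
  by rewrite lee_fin powR_ge0.
rewrite -sumEFin -(big_mkord xpredT (fun k => (`|y k| `^ q)%:E)).
by apply: nneseries_lim_ge => k _ _; rewrite lee_fin powR_ge0.
Qed.

Lemma seq_norm_gtNy p y : (-oo < seq_norm (depth_exponent p) y)%E.
Proof.
rewrite /depth_exponent; case: ifPn => [_|]; last first.
  rewrite -ltNge => p1; have := depth_exponentE p1.
  rewrite /depth_exponent leNgt p1 /= => ->.
  by rewrite (lt_le_trans _ (poweR_ge0 _ _))// ltNyr.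
apply: (@lt_le_trans _ _ `|y 0%N|%:E); first exact: ltNyr.
by apply: ereal_sup_ubound; exists 0%N.
Qed.

(** The value at 0 is 1, so that the absolute value is 1 everywhere. *)
Let sign x : R := if x < 0 then -1 else 1.

Let mul_sign x : sign x * x = `|x|.
Proof. by rewrite /sign; case: ltrgt0P => [||->]; rewrite ?mul1r ?mulN1r. Qed.

Let norm_sign x : `|sign x| = 1.
Proof. by rewrite /sign; case: ifP; rewrite ?normrN1 ?normr1. Qed.

Lemma coordinate_pairing p y j : 0 < p ->
  exists n b, [/\ \sum_(k < n) `|b k| `^ p = 1 & \sum_(k < n) b k * y k = `|y j|].
Proof.
(* The signed unit vector at [j]; length [j.+1] is the first to include that index. *)
move=> p0; exists j.+1, (fun k => if k == j then sign (y j) else 0).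
split.
  rewrite big_ord_recr /= eqxx norm_sign powR1 big1 ?add0r// => k _.
  by rewrite ltn_eqF// normr0 powR0// gt_eqF.
rewrite big_ord_recr /= eqxx mul_sign big1 ?add0r// => k _.
by rewrite ltn_eqF// mul0r.
Qed.

(** For [p <= 1] one coordinate suffices. For [1 < p] the extremal sequence of the Hoelder
    inequality is truncated where the partial sum of [|y k|^q] exceeds [x^q]. *)
Lemma seq_norm_approx p y x : 0 < p -> (x%:E < seq_norm (depth_exponent p) y)%E ->
  exists n b, 0 < \sum_(k < n) `|b k| `^ p /\
    x <= (\sum_(k < n) b k * y k) / (\sum_(k < n) `|b k| `^ p) `^ p^-1.
Proof.
move=> p0; have coord j : x <= `|y j| -> exists n b, 0 < \sum_(k < n) `|b k| `^ p /\
    x <= (\sum_(k < n) b k * y k) / (\sum_(k < n) `|b k| `^ p) `^ p^-1.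
  move=> xy; have [n [b [N1 by']]] := coordinate_pairing y j p0.
  by exists n, b; rewrite N1 by' powR1 divr1.
have [p1|p1] := leP p 1.
  rewrite /depth_exponent p1 /= => /ereal_sup_gt[_ [j _ <-]].
  by rewrite lte_fin => /ltW; exact: coord.
rewrite depth_exponentE//; set q := p / (p - 1) => xM.
have [x0|x0] := ltP x 0; first by apply: (coord 0%N); rewrite (le_trans (ltW x0)).
have q0 : 0 < q by rewrite divr_gt0// subr_gt0.
(* If every partial sum were at most [x^q], the norm would be at most [x]; this uses [x >= 0],
   negative [x] having been settled by a coordinate. *)
have [n nx] : exists n, x `^ q < \sum_(k < n) `|y k| `^ q.
  apply: contrapT => /forallNP h; move: xM; apply/negP; rewrite -leNgt /seq_norm.
  rewrite -[leRHS]poweRe1 ?lee_fin// -(mulfV (lt0r_neq0 q0)) poweRrM.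
  apply: gt0_ler_poweR.
  - by rewrite invr_ge0 ltW.
  - rewrite in_itv/= leey andbT; apply: nneseries_ge0 => k _ _.
    by rewrite lee_fin powR_ge0.
  - by rewrite in_itv/= leey andbT lee_fin powR_ge0.
  apply: lime_le.
    by apply: is_cvg_nneseries => k _ _; rewrite lee_fin powR_ge0.
  apply: nearW => n; rewrite big_mkord sumEFin lee_fin leNgt.
  by apply/negP; exact: h.
(* Equality case of Hoelder: as [(q - 1) p = q], both [b k * y k] and [|b k|^p] equal [|y k|^q].
   With [A] their sum, the quotient is [A^(1 - 1/p) = A^(1/q)], which exceeds [x]. *)
pose b k := sign (y k) * `|y k| `^ (q - 1).
have byE k : b k * y k = `|y k| `^ q.
  by rewrite /b mulrAC mul_sign mulr_powRB1.
have bpE k : `|b k| `^ p = `|y k| `^ q.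
  rewrite /b normrM norm_sign mul1r ger0_norm ?powR_ge0// -powRrM; congr powR.
  by rewrite /q; field; rewrite subr_eq0 gt_eqF.
have xq0 : 0 <= x `^ q by exact: powR_ge0.
exists n, b; under eq_bigr do rewrite bpE.
under [X in _ /\ _ <= X / _]eq_bigr do rewrite byE.
move: nx; set A := \sum_(k < n) _ => nx.
have A0 : 0 < A by exact: le_lt_trans nx.
split => //; rewrite -[X in X / _]powRr1 ?(ltW A0)// -powRB; last first.
  by apply/implyP => _; rewrite gt_eqF.
have -> : 1 - p^-1 = q^-1 by rewrite -(depth_conjugate p1) -/q; ring.
rewrite -[leLHS]powRr1// -(mulfV (lt0r_neq0 q0)) powRrM.
by rewrite ge0_ler_powR ?nnegrE ?invr_ge0 ?(ltW q0) ?(ltW A0) ?(ltW nx).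
Qed.

End dual_norm.

(** * Characteristic functions of linear combinations *)

Section stable_sums.
Context {R : realType} {d : measure_display} {Omega : measurableType d}.
Variable P : probability Omega R.

Lemma same_law_Rintegral {d'} {Omega' : measurableType d'} (Q : probability Omega' R)
    (Y : Omega -> R) (Z : Omega' -> R) (f : R -> R) (M : R) :
  measurable_fun setT Y -> measurable_fun setT Z -> same_law P Y Q Z ->
  measurable_fun setT f -> (forall x, `|f x| <= M) ->
  \int[P]_w f (Y w) = \int[Q]_w f (Z w).
Proof.
move=> mY mZ YZ mf fM.
pose Y' : {mfun Omega >-> R} := HB.pack Y (isMeasurableFun.Build _ _ _ _ _ mY).
pose Z' : {mfun Omega' >-> R} := HB.pack Z (isMeasurableFun.Build _ _ _ _ _ mZ).
have mfE : measurable_fun setT (EFin \o f) by exact/measurable_EFinP.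
have iY : P.-integrable setT ((EFin \o f) \o Y').
  apply: (@probability_bounded_integrable _ _ _ P (f \o Y) M) => //=.
  exact: measurableT_comp.
have iZ : Q.-integrable setT ((EFin \o f) \o Z').
  apply: (@probability_bounded_integrable _ _ _ Q (f \o Z) M) => //=.
  exact: measurableT_comp.
rewrite /Rintegral; congr fine.
transitivity (\int[distribution P Y']_x (f x)%:E)%E.
  by rewrite (integral_distribution mfE iY).
transitivity (\int[distribution Q Z']_x (f x)%:E)%E; last first.
  by rewrite (integral_distribution mfE iZ).
by apply: eq_measure_integral => A mA _; exact: YZ.
Qed.

Variables (Y : nat -> Omega -> R) (l c : nat -> R) (g p : R).
Hypothesis mY : forall k, measurable_fun setT (Y k).
Hypothesis indepY : mutually_independent P Y.
Hypothesis cosY : forall k u,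
  \int[P]_w cos (u * Y k w) = expR (- (g * `|u * c k| `^ p)).
Hypothesis sinY : forall k u, \int[P]_w sin (u * Y k w) = 0.

(** Cosine and sine go through one induction, since the addition formulas mix them. Independence
    factors each product, every product containing a sine integral vanishes, and the exponents of
    the remaining cosine factors add up. *)
Lemma charfun_partial_sum n u :
  \int[P]_w cos (u * partial_sum Y l n w) =
    expR (- (g * (\sum_(k < n) `|l k * c k| `^ p) * `|u| `^ p)) /\
  \int[P]_w sin (u * partial_sum Y l n w) = 0.
Proof.
elim: n => [|n [IHc IHs]].
  have S0 w : partial_sum Y l 0 w = 0 by rewrite /partial_sum big_ord0.
  rewrite big_ord0 mulr0 mul0r oppr0 expR0.
  under eq_Rintegral do rewrite S0 mulr0 cos0.
  under [X in _ /\ X = _]eq_Rintegral do rewrite S0 mulr0 sin0.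
  rewrite !Rintegral_cst// mul0r mul1r; split => //.
  by rewrite [fine (P _)](_ : _ = 1)// probability_setT.
have mS := measurable_partial_sum l mY n.
have UV := partial_sum_indep l mY indepY n.
have mc v : measurable_fun setT (fun x : R => cos (v * x)).
  by apply: (measurableT_comp measurable_cos); exact: measurable_funM.
have ms v : measurable_fun setT (fun x : R => sin (v * x)).
  by apply: (measurableT_comp measurable_sin); exact: measurable_funM.
have bc v (x : R) : `|cos (v * x)| <= 1 by rewrite ler_norml cos_geN1 cos_le1.
have bs v (x : R) : `|sin (v * x)| <= 1 by rewrite ler_norml sin_geN1 sin_le1.
have split_arg w : u * partial_sum Y l n.+1 w =
    u * partial_sum Y l n w + (u * l n) * Y n w.
  by rewrite partial_sumS mulrDr mulrA.
have bounded_prod (f h : R -> R) : measurable_fun setT f -> measurable_fun setT h ->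
    (forall x, `|f x| <= 1) -> (forall x, `|h x| <= 1) ->
    P.-integrable setT (EFin \o (fun w => f (partial_sum Y l n w) * h (Y n w))).
  move=> mf mh bf bh; apply: (@probability_bounded_integrable _ _ _ P _ 1).
    by apply: measurable_funM; exact: measurableT_comp.
  by move=> w; rewrite normrM mulr_ile1.
split.
- under eq_Rintegral do rewrite split_arg cosD.
  rewrite RintegralB//; first last.
  - exact: (bounded_prod _ _ (ms u) (ms (u * l n)) (bs u) (bs (u * l n))).
  - exact: (bounded_prod _ _ (mc u) (mc (u * l n)) (bc u) (bc (u * l n))).
  rewrite (@indep_pair_Rintegral _ _ _ P _ _ (fun x => cos (u * x))
     (fun x => cos (u * l n * x)) 1 1)//.
  rewrite (@indep_pair_Rintegral _ _ _ P _ _ (fun x => sin (u * x))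
     (fun x => sin (u * l n * x)) 1 1)//.
  rewrite IHc IHs mul0r subr0 cosY -expRD; congr expR.
  rewrite big_ord_recr /=.
  have -> : `|u * l n * c n| `^ p = `|u| `^ p * `|l n * c n| `^ p.
    by rewrite -mulrA normrM powRM.
  by ring.
- under eq_Rintegral do rewrite split_arg sinD.
  rewrite RintegralD//; first last.
  - exact: (bounded_prod _ _ (mc u) (ms (u * l n)) (bc u) (bs (u * l n))).
  - exact: (bounded_prod _ _ (ms u) (mc (u * l n)) (bs u) (bc (u * l n))).
  rewrite (@indep_pair_Rintegral _ _ _ P _ _ (fun x => sin (u * x))
     (fun x => cos (u * l n * x)) 1 1)//.
  rewrite (@indep_pair_Rintegral _ _ _ P _ _ (fun x => cos (u * x))
     (fun x => sin (u * l n * x)) 1 1)//.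
  by rewrite IHs sinY mul0r mulr0 addr0.
Qed.

End stable_sums.

(** * Infimum of tails over thresholds approaching a level *)

Section stable_tail.
Context {R : realType} {d : measure_display} {Omega : measurableType d}.
Variables (P : probability Omega R) (S : {RV P >-> R}).

Lemma measurable_ge (x : R) : measurable [set w | x <= S w].
Proof.
rewrite (_ : [set w | _] = S @^-1` `[x, +oo[).
  by apply: measurable_preimage => //; exact: measurable_itv.
by apply/seteqP; split=> w /=; rewrite in_itv/= andbT.
Qed.

Lemma measurable_ereal_le (m : \bar R) : measurable [set w | ((S w)%:E <= m)%E].
Proof.
case: m => [r| |].
- rewrite (_ : [set w | _] = S @^-1` `]-oo, r]).
    by apply: measurable_preimage => //; exact: measurable_itv.
  by apply/seteqP; split=> w /=; rewrite in_itv/= lee_fin.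
- rewrite (_ : [set w | _] = setT)//.
  by apply/seteqP; split=> w //= _; rewrite leey.
- rewrite (_ : [set w | _] = set0)//.
  by apply/seteqP; split=> w //=.
Qed.

(** Thresholds in [T] above levels [z n] increasing to [m] bound the infimum by the tails at [z n].
    Continuity from above yields [P (S >= m)], and the absence of atoms turns it into
    [P (S > m)]. *)
Lemma ereal_inf_tail (T : set R) (m : \bar R) :
  (forall x, P [set w | S w = x] = 0%E) ->
  (-oo < m)%E ->
  (forall x : R, (x%:E < m)%E -> exists2 y, T y & x <= y) ->
  (ereal_inf [set P [set w | (y <= S w)%R] | y in T] <=
   1 - P [set w | ((S w)%:E <= m)%E])%E.
Proof.
move=> noatom mNy approx.
have mle := measurable_ereal_le m.
(* For finite [m] the levels approach it strictly from below; for [m = +oo] they are the integers.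
   The value [m = -oo] is ruled out by [mNy]. *)
pose z n : R := if m is r%:E then r - n.+1%:R^-1 else n%:R.
have zm n : ((z n)%:E < m)%E.
  move: mNy; rewrite /z; case: (m) => [r| |//]; last by move=> _; rewrite ltry.
    by move=> _; rewrite lte_fin ltrBlDr ltrDl invr_gt0.
have zmono : {homo z : i j / (i <= j)%N >-> i <= j}.
  move=> i j ij; rewrite /z; case: (m) => [r||]; rewrite ?ler_nat//.
  by rewrite lerB// lef_pV2 ?posrE// ler_nat.
(* For [m = +oo] both sides are empty, as a real number [S w] lies below some integer. *)
have capz : \bigcap_n [set w | z n <= S w] = [set w | (m <= (S w)%:E)%E].
  apply/seteqP; split=> w /=.
  - move=> h; move: mNy h; rewrite /z; case: (m) => [r| |//] _ h.
      rewrite lee_fin; apply/ler_addgt0Pr => e e0.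
      have [k ke] := ltr_add_invr e0; rewrite add0r in ke.
      have := h k I; rewrite /= lerBlDr => /le_trans; apply.
      by rewrite lerD2l ltW.
    have := h (Num.truncn (S w)).+1 I; rewrite /= leNgt => /negP; case.
    exact: truncnS_gt.
  - by move=> mS n _ /=; rewrite -lee_fin (le_trans _ mS)// ltW.
have le_z n : (ereal_inf [set P [set w | (y <= S w)%R] | y in T] <=
    P [set w | (z n <= S w)%R])%E.
  have [y Ty zy] := approx _ (zm n).
  apply: ge_ereal_inf; exists (P [set w | y <= S w]); first by exists y.
  rewrite le_measure ?inE//; [exact: measurable_ge|exact: measurable_ge|].
  by move=> w /=; exact: le_trans.
have cvg_z : P [set w | z n <= S w] @[n --> \oo] --> P [set w | (m <= (S w)%:E)%E].
  rewrite -capz; apply: nonincreasing_cvg_mu.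
  - by rewrite (le_lt_trans (probability_le1 P (measurable_ge _)))// ltry.
  - by move=> n; exact: measurable_ge.
  - by apply: bigcap_measurable => // n _; exact: measurable_ge.
  - move=> i j ij; apply/subsetPset => w /=; apply: le_trans; exact: zmono.
have -> : (1 - P [set w | ((S w)%:E <= m)%E] = P [set w | (m < (S w)%:E)%E])%E.
  rewrite -probability_setC//; congr (P _).
  by apply/seteqP; split=> w /=; rewrite ltNge => /negP.
have -> : P [set w | (m < (S w)%:E)%E] = P [set w | (m <= (S w)%:E)%E].
  case: (m) => [r| |] /=.
  - rewrite (_ : [set w | (r%:E <= (S w)%:E)%E] =
        [set w | (r%:E < (S w)%:E)%E] `|` [set w | S w = r]); last first.
      apply/seteqP; split=> w /=; rewrite ?lee_fin ?lte_fin.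
        by rewrite le_eqVlt => /predU1P[->|]; [right|left].
      by case=> [/ltW//|->].
    have mlt : measurable [set w | (r%:E < (S w)%:E)%E].
      rewrite (_ : [set w | _] = ~` [set w | ((S w)%:E <= r%:E)%E]).
        exact: measurableC (measurable_ereal_le _).
      by apply/seteqP; split=> w /=; rewrite ltNge => /negP.
    have meq : measurable [set w | S w = r].
      by rewrite (_ : [set w | _] = S @^-1` [set r])//; exact: measurable_preimage.
    rewrite measureU//; first by rewrite [X in (_ + X)%E]noatom adde0.
    by apply/seteqP; split=> w //= []; rewrite lte_fin => + Sr; rewrite Sr ltxx.
  - by congr (P _); apply/seteqP; split=> w.
  - by congr (P _); apply/seteqP; split=> w //= _; rewrite ?leNye ?ltNyr.
rewrite -(cvg_lim _ cvg_z)//.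
apply: lime_ge; first by apply/cvg_ex; eexists; exact: cvg_z.
by apply: nearW => n; exact: le_z.
Qed.

End stable_tail.

(** * Tails of a rescaled stable variable *)

Section scaled_tail.
Context {R : realType} {dS d : measure_display}.
Context {OmegaS : measurableType dS} {Omega : measurableType d}.
Variables (PS : probability OmegaS R) (S : OmegaS -> R).
Variables (P : probability Omega R) (Z : Omega -> R) (g p N : R).
Hypotheses (mS : measurable_fun setT S) (mZ : measurable_fun setT Z).
Hypotheses (p0 : 0 < p) (N0 : 0 < N).
Hypothesis cosS : forall u, \int[PS]_w cos (u * S w) = expR (- (g * `|u| `^ p)).
Hypothesis sinS : forall u, \int[PS]_w sin (u * S w) = 0.
Hypothesis cosZ : forall u,
  \int[P]_w cos (u * Z w) = expR (- (g * N * `|u| `^ p)).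
Hypothesis sinZ : forall u, \int[P]_w sin (u * Z w) = 0.

(** With [s^p = N], the variables [Z] and [s * S] have the same cosine and sine integrals, hence the
    same tails. *)
Lemma stable_scaled_tail (m : R) :
  P [set w | m <= Z w] = PS [set w | m / N `^ p^-1 <= S w].
Proof.
set s := N `^ p^-1; have s0 : 0 < s by rewrite powR_gt0.
have sp : s `^ p = N by rewrite /s -powRrM mulVf ?gt_eqF// powRr1// ltW.
rewrite (@upper_halfline_prob_eq _ _ _ _ _ P PS Z (fun w => s * S w))//.
- by congr (PS _); apply/seteqP; split=> w /=; rewrite ler_pdivrMr// mulrC.
- exact: measurable_funM.
- move=> u; under [RHS]eq_Rintegral do rewrite mulrA.
  rewrite cosZ cosS normrM powRM// (gtr0_norm s0) sp; congr expR; ring.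
- move=> u; under [RHS]eq_Rintegral do rewrite mulrA.
  by rewrite sinZ sinS.
Qed.

End scaled_tail.

(** * The depth formula as two inequalities *)

Unset Implicit Arguments.

Theorem proposition1 (R : realType) (p : R) (hp0 : 0 < p) (hp2 : p <= 2)
  (dS : measure_display) (OmegaS : measurableType dS)
  (PS : probability OmegaS R) (S : {RV PS >-> R})
  (hS : nondegenerate_symmetric_stable PS p S)
  (c : nat -> R) (hc : forall k, 0 < c k)
  (B : topologicalLmodType R) (hB : separable_Fspace B)
  (d : measure_display) (Omega : measurableType d) (P : probability Omega R)
  (X : {RV P >-> borel B})
  (t : nat -> {mfun borel B >-> R})
  (hindep : mutually_independent P (fun k => t k \o X))
  (hlaw : forall k,
     same_law P (t k \o X) PS (fun w => c k * S w)) :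
  forall a : B,
    half_space_depth (finite_linear_combinations (fun k x => t k x)) a (distribution P X) =
    (1 - PS [set w | (S w)%:E <=
               seq_norm (depth_exponent p) (fun k => t k a / c k)%R])%E.
Proof.
move=> a; case: hS => g g0 cfS.
have cosS u : \int[PS]_w cos (u * S w) = expR (- (g * `|u| `^ p)).
  by have := cfS u; rewrite /char_fun unlock => -[+ _].
have sinS u : \int[PS]_w sin (u * S w) = 0.
  by have := cfS u; rewrite /char_fun unlock => -[_ +].
have mS : measurable_fun setT S by [].
have mY k : measurable_fun setT (t k \o X) by exact: measurableT_comp.
have mcS k : measurable_fun setT (fun w => c k * S w) by exact: measurable_funM.
have cosY k u : \int[P]_w cos (u * (t k \o X) w) = expR (- (g * `|u * c k| `^ p)).
  rewrite (same_law_Rintegral (f := fun x => cos (u * x)) (M := 1)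
    (mY k) (mcS k) (hlaw k)).
  - by under eq_Rintegral do rewrite mulrA; rewrite cosS.
  - by apply: (measurableT_comp measurable_cos); exact: measurable_funM.
  - by move=> x; rewrite ler_norml cos_geN1 cos_le1.
have sinY k u : \int[P]_w sin (u * (t k \o X) w) = 0.
  rewrite (same_law_Rintegral (f := fun x => sin (u * x)) (M := 1)
    (mY k) (mcS k) (hlaw k)).
  - by under eq_Rintegral do rewrite mulrA; rewrite sinS.
  - by apply: (measurableT_comp measurable_sin); exact: measurable_funM.
  - by move=> x; rewrite ler_norml sin_geN1 sin_le1.
have noatom := stable_no_atom mS g0 hp0 cosS sinS.
pose N n (b : nat -> R) := \sum_(k < n) `|b k| `^ p.
pose y k := t k a / c k.
pose depth n (l : nat -> R) := distribution P X
  [set x | \sum_(k < n) l k * t k a <= \sum_(k < n) l k * t k x].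
(* The substitution [b k = l k * c k] turns the value at [a] of the combination into the pairing of
   [b] with [y], and its scale into the [p]-norm of [b]. *)
have depthE n l b : (forall k, l k * c k = b k) -> 0 < N n b ->
    depth n l = PS [set w | (\sum_(k < n) b k * y k) / N n b `^ p^-1 <= S w].
  move=> lb N0.
  have bE : N n b = \sum_(k < n) `|l k * c k| `^ p.
    by apply: eq_bigr => k _; rewrite lb.
  rewrite -(@stable_scaled_tail _ _ _ _ _ PS S P
      (partial_sum (fun k => t k \o X) l n) g p _ mS _ hp0 N0)//.
  - rewrite [X in [set w | X <= _]](_ : _ = \sum_(k < n) l k * t k a)//.
    by apply: eq_bigr => k _; rewrite -lb /y -mulrA [c k * _]mulrC divfK ?gt_eqF.
  - exact: measurable_partial_sum.
  - by move=> u; rewrite bE; have [] := charfun_partial_sum l mY hindep cosY sinY n u.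
  - by move=> u; have [] := charfun_partial_sum l mY hindep cosY sinY n u.
rewrite -/y; set M := seq_norm _ y.
have mM := measurable_ereal_le S M.
apply/eqP; rewrite eq_le; apply/andP; split.
(* Upper bound: [T] collects the thresholds of the combinations with nonzero scale, all of the form
   [depthE], and comes arbitrarily close to [M] from below. *)
- pose T := [set r | exists n b, 0 < N n b /\
    r = (\sum_(k < n) b k * y k) / N n b `^ p^-1].
  apply: le_trans (@ereal_inf_tail _ _ _ PS S T M noatom _ _).
  + apply: ereal_inf_le_tmp => _ [_ [n [b [N0 ->]]] <-].
    exists (fun x => \sum_(k < n) b k / c k * t k x).
      by exists n, (fun k => b k / c k).
    have := depthE n (fun k => b k / c k) b _ N0; apply => k.
    by rewrite divfK// gt_eqF.
  + exact: seq_norm_gtNy.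
  + move=> x /(seq_norm_approx hp0)[n [b [N0 xb]]].
    by exists ((\sum_(k < n) b k * y k) / N n b `^ p^-1) => //; exists n, b.
(* Lower bound: the event [S > M] is compared with the half-space of each single combination. *)
- apply: le_ereal_inf_tmp => _ [_ [n [l ->]] <-].
  rewrite -probability_setC//.
  change (PS (~` [set w | ((S w)%:E <= M)%E]) <= depth n l)%E.
  pose b k := l k * c k.
  have /predU1P[N0|N0] : (0 == N n b) || (0 < N n b).
    by rewrite -le_eqVlt; apply: sumr_ge0 => k _; exact: powR_ge0.
  (* Zero scale forces all coefficients to vanish, since [c k > 0]; the half-space is then the whole
     space. *)
  - rewrite [leRHS](_ : _ = 1%E); first by apply: probability_le1; exact: measurableC.
    rewrite -(probability_setT (distribution P X)); congr (distribution P X _).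
    have l0 (k : 'I_n) : l k = 0.
      have /eqP := esym N0; rewrite psumr_eq0; last by move=> i _; exact: powR_ge0.
      move=> /allP/(_ k (mem_index_enum _)); rewrite powR_eq0 normr_eq0 mulf_eq0.
      by rewrite (gt_eqF (hc k)) orbF => /andP[/eqP].
    apply/seteqP; split=> // x _ /=.
    by rewrite big1 ?big1// => k _; rewrite l0 mul0r.
  (* The threshold is at most [M] by duality, so [S > M] is contained in the tail event. *)
  - rewrite (depthE n l b)// le_measure ?inE//.
    + exact: measurableC.
    + exact: measurable_ge.
    + move=> w /= /negP; rewrite -ltNge => MS.
      rewrite -lee_fin (le_trans _ (ltW MS))//.
      exact: pairing_le_seq_norm.
Qed.
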